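(* Let $A\subseteq R$ be an extension of (additively idempotent) semirings with $R$ cancellative. Then the following subsets of $R$ are all equal: the downward closure $\{x\in R: x\le a\text{ for some }a\in A\}$ of $A$ in $R$, the J-integral closure $\overline{A}^{\mathrm{J}}$, the D-integral closure $\overline{A}^{\mathrm{D}}$, the quasi-integral closure $\overline{A}^{\mathrm{Q}}$, and the valuative integral closure $\overline{A}^{\mathrm{V}}$ of $A$ in $R$.
   Context: Semirings are commutative, with $0$ and $1$, satisfy $a\cdot 0=0$, and are additively idempotent ($a+a=a$); the order is $a\le b\iff a+b=b$. An element $s\neq 0$ of a semiring is cancellative if $sb=sc$ implies $b=c$; a semiring is cancellative if all its nonzero elements are cancellative. $A$ is a sub-semiring of $R$. An element $x\in R$ is J-integral over $A$ if $x^n\le\sum_{i=0}^{n-1}a_ix^i$ for some positive integer $n$ and $a_i\in A$; it is D-integral over $A$ if $x\le y$ for some $y\in R$ that is J-integral over $A$. Let $A\langle x\rangle$ be the smallest downward-closed sub-semiring of $R$ containing $A$ and $x$ (a subset $I$ is downward-closed if $x\le y\in I$ implies $x\in I$). $x$ is quasi-integral over $A$ if there is an $A\langle x\rangle$-submodule $M\subseteq R$ that is finite as a downward-closed $A$-module (i.e. $M$ is the downward closure in $R$ of a finitely generated $A$-submodule $L\subseteq M$) and that is faithful as an $A\langle x\rangle$-module (if $a,b\in A\langle x\rangle$ satisfy $am=bm$ for all $m\in M$, then $a=b$). $\overline{A}^{\mathrm{J}},\overline{A}^{\mathrm{D}},\overline{A}^{\mathrm{Q}}$ denote the sets of J-integral,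 D-integral, quasi-integral elements of $R$ over $A$. A congruence is an equivalence relation compatible with $+$ and $\cdot$. A proper congruence $P$ on $R$ is prime if $R/P$ is totally ordered and cancellative; $\kappa(P)$ denotes the total semiring of fractions of $R/P$ (a semifield) and $|x|_P$ the image of $x$ in $\kappa(P)$. Put $R_P=\{x\in R: |x|_P\le 1_{\kappa(P)}\}$. Then $\overline{A}^{\mathrm{V}}$ is the intersection of all $R_P$ over prime congruences $P$ on $R$ with $A\subseteq R_P$. *)

(* Defs.v *)
From HB Require Import structures.
From mathcomp Require Import all_boot all_order all_algebra.
From mathcomp Require Import all_classical.

Set Implicit Arguments.
Unset Strict Implicit.
Unset Printing Implicit Defensive.

Import GRing.Theory.
Local Open Scope ring_scope.
Local Open Scope quotient_scope.
Local Open Scope classical_set_scope.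

(* The canonical order of an additively idempotent semiring. Idempotence is not
   bundled in a structure: it is a separate hypothesis on the semiring. *)
Definition sle (R : nmodType) (a b : R) : Prop := a + b = b.
Notation "a <=+ b" := (sle a b) (at level 70, no associativity) : ring_scope.

(* GRing.lreg s says that multiplication by s is injective; in the zero semiring
   this holds for s = 0, so the nonzero condition is stated separately. *)
Definition cancellative (R : comPzSemiRingType) : Prop :=
  forall s : R, s != 0 -> GRing.lreg s.

Definition sle_total (R : nmodType) : Prop :=
  forall a b : R, a <=+ b \/ b <=+ a.

(* equiv_rel is bool-valued; by asbool it covers every equivalence relation. *)
Record congruence (R : comPzSemiRingType) := Congruence {
  congr_rel :> equiv_rel R;
  congr_add : forall x x' y y' : R,
    congr_rel x x' -> congr_rel y y' -> congr_rel (x + y) (x' + y');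
  congr_mul : forall x x' y y' : R,
    congr_rel x x' -> congr_rel y y' -> congr_rel (x * y) (x' * y')
}.

Definition quot (R : comPzSemiRingType) (P : congruence R) : Type :=
  {eq_quot P}.

Section Quotient.
Variables (R : comPzSemiRingType) (P : congruence R).
Local Notation Q := (quot P).

HB.instance Definition _ := Choice.on Q.
HB.instance Definition _ := EqQuotient.on Q.

Definition quot_proj (x : R) : Q := \pi_Q x.

Definition quot_add (a b : Q) : Q := quot_proj (repr a + repr b).
Definition quot_mul (a b : Q) : Q := quot_proj (repr a * repr b).

Lemma quot_projP (x y : R) : quot_proj x = quot_proj y <-> P x y.
Proof. by split=> [/eqmodP|h]; last exact/eqmodP. Qed.

Lemma quot_repr (x : R) : P (repr (quot_proj x)) x.
Proof. by apply/quot_projP; rewrite /quot_proj reprK. Qed.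

Lemma quot_projD (x y : R) :
  quot_add (quot_proj x) (quot_proj y) = quot_proj (x + y).
Proof. by apply/quot_projP/congr_add; apply: quot_repr. Qed.

Lemma quot_projM (x y : R) :
  quot_mul (quot_proj x) (quot_proj y) = quot_proj (x * y).
Proof. by apply/quot_projP/congr_mul; apply: quot_repr. Qed.

Lemma quot_ind (K : Q -> Prop) : (forall x, K (quot_proj x)) -> forall a, K a.
Proof. by move=> h a; rewrite -[a]reprK; apply: h. Qed.

Lemma quot_addA : associative quot_add.
Proof.
by elim/quot_ind=> x; elim/quot_ind=> y; elim/quot_ind=> z;
  rewrite !quot_projD addrA.
Qed.
Lemma quot_addC : commutative quot_add.
Proof.
by elim/quot_ind=> x; elim/quot_ind=> y; rewrite !quot_projD addrC.
Qed.
Lemma quot_add0 : left_id (quot_proj 0) quot_add.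
Proof. by elim/quot_ind=> x; rewrite quot_projD add0r. Qed.

HB.instance Definition _ :=
  GRing.isNmodule.Build Q quot_addA quot_addC quot_add0.

Lemma quot_mulA : associative quot_mul.
Proof.
by elim/quot_ind=> x; elim/quot_ind=> y; elim/quot_ind=> z;
  rewrite !quot_projM mulrA.
Qed.
Lemma quot_mulC : commutative quot_mul.
Proof.
by elim/quot_ind=> x; elim/quot_ind=> y; rewrite !quot_projM mulrC.
Qed.
Lemma quot_mul1 : left_id (quot_proj 1) quot_mul.
Proof. by elim/quot_ind=> x; rewrite quot_projM mul1r. Qed.
Lemma quot_mulDl : left_distributive quot_mul quot_add.
Proof.
by elim/quot_ind=> x; elim/quot_ind=> y; elim/quot_ind=> z;
  rewrite !(quot_projM, quot_projD) mulrDl.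
Qed.
Lemma quot_mul0 : left_zero (quot_proj 0) quot_mul.
Proof. by elim/quot_ind=> x; rewrite quot_projM mul0r. Qed.

HB.instance Definition _ := GRing.Nmodule_isComPzSemiRing.Build Q
  quot_mulA quot_mulC quot_mul1 quot_mulDl quot_mul0.

End Quotient.

(* The total semiring of fractions: the localization at the multiplicative set
   of elements s with GRing.lreg s. In a nonzero semiring these are exactly the
   cancellative elements, 0 being excluded because 0 * 0 = 0 * 1. *)
Section Fractions.
Variable R : comPzSemiRingType.

Record denom := Denom { denom_val : R; _ : `[< GRing.lreg denom_val >] }.
HB.instance Definition _ := [isSub for denom_val].
HB.instance Definition _ := [Choice of denom by <:].

Definition frac_rel : rel (R * denom) :=
  fun p q => p.1 * denom_val q.2 == q.1 * denom_val p.2.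

Lemma denomP (s : denom) : GRing.lreg (denom_val s).
Proof. by case: s => s hs; apply/asboolP. Qed.

Lemma frac_rel_refl : reflexive frac_rel.
Proof. by move=> p; rewrite /frac_rel. Qed.
Lemma frac_rel_sym : symmetric frac_rel.
Proof. by move=> p q; rewrite /frac_rel eq_sym. Qed.
Lemma frac_rel_trans : transitive frac_rel.
Proof.
move=> q p r /eqP pq /eqP qr; apply/eqP; apply: (denomP (s := q.2)).
rewrite [LHS](AC (1*2) ((2*1)*3)) /= pq [LHS](AC (2*1) ((1*3)*2)) /= qr.
by rewrite [RHS](AC (1*2) ((2*1)*3)).
Qed.
Canonical frac_equiv :=
  EquivRel frac_rel frac_rel_refl frac_rel_sym frac_rel_trans.

Definition fracs : Type := {eq_quot frac_equiv}.
Local Notation K := fracs.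

HB.instance Definition _ := Choice.on K.
HB.instance Definition _ := EqQuotient.on K.

Lemma denom1_subproof : `[< GRing.lreg (1 : R) >].
Proof. by apply/asboolP => b c; rewrite !mul1r. Qed.
Definition denom1 : denom := Denom denom1_subproof.

Lemma denomM_subproof (s t : denom) : `[< GRing.lreg (denom_val s * denom_val t) >].
Proof.
by apply/asboolP => b c; rewrite -!mulrA => /(denomP (s := s))/(denomP (s := t)).
Qed.
Definition denomM (s t : denom) : denom := Denom (denomM_subproof s t).

Definition mkfrac (a : R) (s : denom) : K := \pi_K (a, s).
Definition frac_embed (a : R) : K := mkfrac a denom1.

Definition frac_add (u v : K) : K :=
  let: (a, s) := repr u in let: (b, t) := repr v in
  mkfrac (a * denom_val t + b * denom_val s) (denomM s t).
Definition frac_mul (u v : K) : K :=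
  let: (a, s) := repr u in let: (b, t) := repr v in
  mkfrac (a * b) (denomM s t).

Lemma mkfracP a s b t : mkfrac a s = mkfrac b t <-> a * denom_val t = b * denom_val s.
Proof. by split=> [/eqmodP/eqP|h]; last exact/eqmodP/eqP. Qed.

Lemma frac_ind (H : K -> Prop) : (forall a s, H (mkfrac a s)) -> forall u, H u.
Proof. by move=> h u; rewrite -[u]reprK; case: (repr u) => a s; apply: h. Qed.

Lemma repr_mkfrac a s :
  (repr (mkfrac a s)).1 * denom_val s = a * denom_val (repr (mkfrac a s)).2.
Proof. by apply/mkfracP; rewrite /mkfrac -surjective_pairing reprK. Qed.

Lemma mkfracD a s b t : frac_add (mkfrac a s) (mkfrac b t) =
  mkfrac (a * denom_val t + b * denom_val s) (denomM s t).
Proof.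
rewrite /frac_add; have := repr_mkfrac a s; have := repr_mkfrac b t.
case: (repr (mkfrac a s)) => a' s'; case: (repr (mkfrac b t)) => b' t' /= hb ha.
apply/mkfracP => /=; rewrite !mulrDl; congr (_ + _).
  by rewrite mulrACA ha [LHS](AC (2*2) ((1*4)*(2*3))).
by rewrite [LHS](AC (2*2) ((1*4)*(2*3))) /= hb [LHS](AC (2*2) ((1*4)*(3*2))).
Qed.

Lemma mkfracM a s b t :
  frac_mul (mkfrac a s) (mkfrac b t) = mkfrac (a * b) (denomM s t).
Proof.
rewrite /frac_mul; have := repr_mkfrac a s; have := repr_mkfrac b t.
case: (repr (mkfrac a s)) => a' s'; case: (repr (mkfrac b t)) => b' t' /= hb ha.
by apply/mkfracP => /=; rewrite mulrACA ha hb mulrACA.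
Qed.

Lemma frac_addA : associative frac_add.
Proof.
elim/frac_ind=> a s; elim/frac_ind=> b t; elim/frac_ind=> c r.
rewrite !mkfracD; apply/mkfracP => /=.
rewrite -[denom_val s * _ * _]mulrA; congr (_ * _).
by rewrite !mulrDl addrA !mulrA; congr (_ + _ + _); apply: mulrAC.
Qed.
Lemma frac_addC : commutative frac_add.
Proof.
elim/frac_ind=> a s; elim/frac_ind=> b t.
by rewrite !mkfracD; apply/mkfracP => /=; rewrite addrC [denom_val t * _]mulrC.
Qed.
Lemma frac_add0 : left_id (frac_embed 0) frac_add.
Proof.
elim/frac_ind=> a s; rewrite mkfracD; apply/mkfracP => /=.
by rewrite mul0r add0r mulr1 mul1r.
Qed.

HB.instance Definition _ :=
  GRing.isNmodule.Build K frac_addA frac_addC frac_add0.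

Lemma frac_mulA : associative frac_mul.
Proof.
elim/frac_ind=> a s; elim/frac_ind=> b t; elim/frac_ind=> c r.
by rewrite !mkfracM; apply/mkfracP => /=; rewrite !mulrA.
Qed.
Lemma frac_mulC : commutative frac_mul.
Proof.
elim/frac_ind=> a s; elim/frac_ind=> b t.
by rewrite !mkfracM; apply/mkfracP => /=; rewrite [b * a]mulrC [denom_val t * _]mulrC.
Qed.
Lemma frac_mul1 : left_id (frac_embed 1) frac_mul.
Proof.
by elim/frac_ind=> a s; rewrite mkfracM; apply/mkfracP => /=; rewrite !mul1r.
Qed.
Lemma frac_mulDl : left_distributive frac_mul frac_add.
Proof.
elim/frac_ind=> a s; elim/frac_ind=> b t; elim/frac_ind=> c r.
rewrite !(mkfracM, mkfracD); apply/mkfracP => /=.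
rewrite [in RHS](mulrACA a c) [in RHS](mulrACA b c) -mulrDl.
by rewrite -!mulrA; congr (_ * (_ * _)); apply: mulrCA.
Qed.
Lemma frac_mul0 : left_zero (frac_embed 0) frac_mul.
Proof.
by elim/frac_ind=> a s; rewrite mkfracM; apply/mkfracP => /=; rewrite !mul0r.
Qed.

HB.instance Definition _ := GRing.Nmodule_isComPzSemiRing.Build K
  frac_mulA frac_mulC frac_mul1 frac_mulDl frac_mul0.

End Fractions.

Section IntegralClosures.
Variable R : comPzSemiRingType.
Implicit Types (A B I L M : set R) (x : R) (P : congruence R).

Definition down_closed I : Prop := forall x y, x <=+ y -> I y -> I x.

Definition down_closure I : set R := [set x | exists2 a, I a & x <=+ a].

Definition j_integral A x : Prop :=
  exists n : nat, (0 < n)%N /\ exists a : 'I_n -> R,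
    (forall i, A (a i)) /\ x ^+ n <=+ \sum_(i < n) a i * x ^+ i.
Definition j_closure A : set R := [set x | j_integral A x].

Definition d_integral A x : Prop := exists2 y, j_integral A y & x <=+ y.
Definition d_closure A : set R := [set x | d_integral A x].

Definition adjoin A x : set R :=
  smallest [set I | semiring_closed [in I] /\ down_closed I] (A `|` [set x]).

Definition submodule B M : Prop :=
  [/\ M 0, forall m m', M m -> M m' -> M (m + m')
    & forall b m, B b -> M m -> M (b * m)].

Definition fin_gen A L : Prop :=
  exists s : seq R, L = smallest [set M | submodule A M] [set` s].

Definition down_finite A M : Prop :=
  exists L, [/\ fin_gen A L, L `<=` M & M = down_closure L].

Definition faithful B M : Prop :=
  forall a b, B a -> B b -> (forall m, M m -> a * m = b * m) -> a = b.

Definition quasi_integral A x : Prop :=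
  exists M, [/\ submodule (adjoin A x) M, down_finite A M
              & faithful (adjoin A x) M].
Definition q_closure A : set R := [set x | quasi_integral A x].

Definition proper_congruence P : Prop := exists x y, ~~ P x y.

Definition prime_congruence P : Prop :=
  [/\ proper_congruence P, sle_total (quot P) & cancellative (quot P)].

Definition kappa P : comPzSemiRingType := fracs (quot P).
Definition kappa_abs P x : kappa P := frac_embed (quot_proj P x).

Definition val_ring P : set R := [set x | kappa_abs P x <=+ 1].

Definition v_closure A : set R :=
  \bigcap_(P in [set P | prime_congruence P /\ A `<=` val_ring P]) val_ring P.

End IntegralClosures.

(* Main.v *)
Require Import Defs.
From mathcomp Require Import all_boot all_order all_algebra.
From mathcomp Require Import all_classical.
From mathcomp Require Import zify.

Set Implicit Arguments.
Unset Strict Implicit.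
Unset Printing Implicit Defensive.

Import GRing.Theory.
Local Open Scope ring_scope.
Local Open Scope classical_set_scope.

(** Write |r| <= |s| for the preorder that a prime congruence induces on R.

    Everything rests on cancellation in the following form: s * a <=+ s * b
    with s nonzero gives a <=+ b.

    - J-integrality: if y ^+ n is below a combination of the lower powers of y
      with coefficients in A, put s = 1 + y + ... + y ^+ (n - 1). Then y * s is
      below b * s for some b in A, so y <=+ b (j_integral_down_closure).
      D-integral elements lie below J-integral ones, so they are covered.
    - Quasi-integrality: if M is generated, up to downward closure, by finitely
      many elements with sum m, then x * m lies in M, hence below a * m for some
      a in A; faithfulness excludes m = 0 when 1 != 0, so x <=+ a
      (quasi_integral_down_closure). Conversely, for x in the downward closure
      of A, that closure is itself a witnessing module.
    - Valuations: given x below no element of A, a prime congruence is needed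
      with |a| <= 1 for all a in A but not |x| <= 1. A prime congruence whose
      only null element is 0 amounts to a proper total preorder on R that
      contains <=+, respects + and * and is cancellative. Start from the
      relation of r to s when r <=+ a * s for some a in A; it does not relate x
      to 1. By Zorn's lemma take a preorder T above it, maximal among those with
      the above properties, totality aside, that do not relate x to 1. If T
      related p and q in neither direction, imposing either |p| <= |q| or
      |q| <= |p| on T would force |x| <= 1. Since (p + q) / q and (p + q) / p
      have meet 1 in the lattice-ordered group of fractions, |x| <= 1 would
      already hold in T (impose_meet). So T is total
      (exists_total_val_preorder), and its associated equivalence is the desired
      prime congruence. Preorders on R itself make it possible to do without the
      semifield of fractions of R. *)

Section CancellativeSemiring.
Context (R : comPzSemiRingType) (idemR : forall a : R, a + a = a).
Implicit Types (a b c d p q r s x y : R) (T : set (R * R)).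

(** * The canonical order *)

Lemma sle_refl a : a <=+ a.
Proof. exact: idemR. Qed.

Lemma sle_trans b a c : a <=+ b -> b <=+ c -> a <=+ c.
Proof. by rewrite /sle => ab <-; rewrite addrA ab. Qed.

Lemma sle_add a b c d : a <=+ b -> c <=+ d -> a + c <=+ b + d.
Proof. by rewrite /sle addrACA => -> ->. Qed.

Lemma sle_addr a b : a <=+ a + b.
Proof. by rewrite /sle addrA idemR. Qed.

Lemma sle_addl a b : a <=+ b + a.
Proof. by rewrite addrC; apply: sle_addr. Qed.

Lemma sle_lub a b c : a <=+ c -> b <=+ c -> a + b <=+ c.
Proof. by move=> ac bc; rewrite -[c]idemR; apply: sle_add. Qed.

Lemma sle_mul2l c a b : a <=+ b -> c * a <=+ c * b.
Proof. by rewrite /sle -mulrDr => ->. Qed.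

Lemma sle_mul a b c d : a <=+ b -> c <=+ d -> a * c <=+ b * d.
Proof.
move=> ab cd; apply: (@sle_trans (a * d)); first exact: sle_mul2l.
by rewrite ![_ * d]mulrC; apply: sle_mul2l.
Qed.

Lemma sle_exp n a b : a <=+ b -> a ^+ n <=+ b ^+ n.
Proof.
by move=> ab; elim: n => [|n IH]; rewrite ?exprS; [apply: sle_refl|apply: sle_mul].
Qed.

Lemma sle0 a : a <=+ 0 -> a = 0.
Proof. by rewrite /sle addr0. Qed.

Lemma sle_sum (I : finType) (F : I -> R) i : F i <=+ \sum_j F j.
Proof. by rewrite (bigD1 i) //=; apply: sle_addr. Qed.

Lemma sum_sle n (F : 'I_n -> R) b : (forall i, F i <=+ b) -> \sum_i F i <=+ b.
Proof.
move=> h; elim/big_ind: _ => [|u v|i _]; [exact: add0r|exact: sle_lub|exact: h].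
Qed.

Hypothesis cancelR : cancellative R.

Lemma sle_cancel s a b : s != 0 -> s * a <=+ s * b -> a <=+ b.
Proof. by move=> s0; rewrite /sle -mulrDr => /(cancelR s0). Qed.

(** * Valuative preorders *)

(** Apart from the full relation, these are the orders induced by the
    cancellative quotients of R in which only 0 becomes null. Totality, which
    makes the quotient prime, is kept apart. *)
Definition val_preorder T : Prop :=
  [/\ forall a b, a <=+ b -> T (a, b),
      forall b a c, T (a, b) -> T (b, c) -> T (a, c),
      forall a b c, T (a, c) -> T (b, c) -> T (a + b, c),
      forall c a b, T (a, b) -> T (c * a, c * b)
    & forall s a b, s != 0 -> T (s * a, s * b) -> T (a, b)].

(** For q nonzero, the least valuative preorder containing T and relating p to q.
    Relating p to q gives (p + q) / q the value 1, so that a power of this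
    fraction may be inserted on the right. *)
Definition impose T p q : set (R * R) :=
  [set rs | exists n, T (q ^+ n * rs.1, (p + q) ^+ n * rs.2)].

Lemma impose_sub T p q : T `<=` impose T p q.
Proof. by case=> a b Tab; exists 0%N; rewrite !expr0 !mul1r. Qed.

Lemma impose_le T p q : val_preorder T -> impose T p q (p, q).
Proof.
case=> Tle _ _ _ _; exists 1%N; rewrite /= !expr1; apply: Tle.
by rewrite mulrC; apply: sle_mul (sle_refl _); apply: sle_addr.
Qed.

(** As q <=+ p + q, the exponent may be increased; this brings two inequalities
    to a common exponent. *)
Lemma impose_lift T p q a b m n : val_preorder T -> (m <= n)%N ->
  T (q ^+ m * a, (p + q) ^+ m * b) -> T (q ^+ n * a, (p + q) ^+ n * b).
Proof.
case=> Tle Ttr _ Tmul _ mn Tab; rewrite -(subnK mn) !exprD -!mulrA.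
apply: (Ttr _ _ _ (Tmul _ _ _ Tab)); apply: Tle.
by apply: sle_mul (sle_refl _); apply/sle_exp/sle_addl.
Qed.

Lemma impose_val_preorder T p q : val_preorder T -> val_preorder (impose T p q).
Proof.
move=> vT; have [Tle Ttr Tadd Tmul Tcan] := vT; split.
- by move=> a b ab; apply/impose_sub/Tle.
- move=> b a c [m /= Tm] [n /= Tn]; exists (m + n)%N => /=.
  rewrite !exprD -!mulrA [q ^+ m * _]mulrCA.
  apply: (Ttr _ _ _ (Tmul _ _ _ Tm)); rewrite mulrCA; exact: Tmul.
- move=> a b c [m /= Tm] [n /= Tn]; exists (maxn m n) => /=.
  rewrite mulrDr; apply: Tadd; [move: Tm|move: Tn]; apply: impose_lift => //.
    exact: leq_maxl.
  exact: leq_maxr.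
- by move=> c a b [n /= Tn]; exists n; rewrite /= !(mulrCA _ c); apply: Tmul.
- move=> s a b s0 [n /=]; rewrite !(mulrCA _ s) => Tn; exists n => /=.
  exact: Tcan Tn.
Qed.

(** For p and q nonzero, (p + q) / q and (p + q) / p have meet 1 in the ordered
    group of fractions, and so do their k-th powers. Without fractions:
    (p + q) ^+ (2 * k) * a expands into monomials in p and q times a. Each
    monomial is divisible by p ^+ k or by q ^+ k, so one of the two hypotheses
    bounds the term by (p + q) ^+ (2 * k) * b. *)
Lemma impose_meet T p q a b : val_preorder T -> p + q != 0 ->
  impose T p q (a, b) -> impose T q p (a, b) -> T (a, b).
Proof.
move=> vT pq0 [m /= Tm] [n /= Tn]; have [Tle Ttr Tadd Tmul Tcan] := vT.
pose k := maxn m n.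
have Tq : T (q ^+ k * a, (p + q) ^+ k * b) by apply: impose_lift Tm; rewrite ?leq_maxl.
have Tp : T (p ^+ k * a, (p + q) ^+ k * b).
  by rewrite addrC; apply: impose_lift Tn; rewrite ?leq_maxr.
have T0 c : T (0, c) by apply: Tle; exact: add0r.
have s0 : (p + q) ^+ (k + k) != 0.
  elim: (k + k)%N => [|j IH].
    apply: contra_neq pq0; rewrite expr0 => e.
    by rewrite -[p + q]mul1r e mul0r.
  apply/negP => /eqP e; move/eqP: IH; apply; apply: (cancelR pq0).
  by rewrite mulr0 -exprS.
apply: (Tcan _ _ _ s0).
have step u w : w <=+ (p + q) ^+ k -> T (u ^+ k * a, (p + q) ^+ k * b) ->
    T (u ^+ k * w * a, (p + q) ^+ (k + k) * b).
  move=> wk Tu; rewrite [u ^+ k * w]mulrC -mulrA exprD -mulrA.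
  by apply: (Ttr _ _ _ (Tmul w _ _ Tu)); apply/Tle/sle_mul; last exact: sle_refl.
have mono i j : (i + j = k)%N -> p ^+ i * q ^+ j <=+ (p + q) ^+ k.
  move=> <-; rewrite exprD; apply: sle_mul; apply: sle_exp.
    exact: sle_addr.
  exact: sle_addl.
rewrite [X in T (X * _, _)]exprDn mulr_suml.
elim/big_ind: _ => [|u v|[i /= ik] _]; [exact: T0|exact: Tadd|].
have: T (p ^+ (k + k - i) * q ^+ i * a, (p + q) ^+ (k + k) * b).
  have [ki|ki] := leqP k i.
    rewrite -[X in q ^+ X](subnKC ki) exprD [p ^+ _ * _]mulrCA.
    apply: (step _ _ _ Tq); apply: mono; lia.
  have -> : (k + k - i = k + (k - i))%N by lia.
  by rewrite exprD -[_ * _ * q ^+ i]mulrA; apply: (step _ _ _ Tp); apply: mono; lia.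
elim: 'C(_, _) => [|c IH] Tc; first by rewrite mulr0n mul0r; apply: T0.
by rewrite mulrS mulrDl; apply: Tadd; last exact: IH.
Qed.

(** A maximal extension of T0 not relating x to y is total: if it related p and q
    in neither direction, imposing either direction would relate x to y, contrary
    to impose_meet. *)
Lemma exists_total_val_preorder T0 x y : val_preorder T0 -> ~ T0 (x, y) ->
  exists T, [/\ val_preorder T, T0 `<=` T, ~ T (x, y)
               & forall p q, T (p, q) \/ T (q, p)].
Proof.
move=> vT0 xT0.
pose good T := [/\ val_preorder T, T0 `<=` T & ~ T (x, y)].
have [F Fgood Ftot|T [Tgood Tmax]] := @Zorn_bigcup _ [set T | T = set0 \/ good T].
  (* The union of the empty chain is empty: this is why the empty relation is
     admitted beside the good ones. *)
  have [[T1 [FT1 [vT1 T01 xyT1]]]|none] := pselect (exists T, F T /\ good T); last first.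
    left; rewrite bigcup0 // => T FT.
    by have [//|gT] := Fgood _ FT; case: none; exists T.
  right; split; last 1 first.
  - move=> [T FT Txy]; have [T_0|[]//] := Fgood _ FT; by rewrite T_0 in Txy.
  - have two (ab cd : R * R) : (\bigcup_(X in F) X) ab -> (\bigcup_(X in F) X) cd ->
        exists T, [/\ F T, T ab, T cd & val_preorder T].
      move=> [T FT Tab] [T' FT' Tcd].
      have vp S z : F S -> S z -> val_preorder S.
        by move=> FS Sz; have [S0|[]//] := Fgood _ FS; rewrite S0 in Sz.
      have [TT'|T'T] := Ftot _ _ FT FT'.
        by exists T'; split=> //; [exact: TT'|exact: vp Tcd].
      by exists T; split=> //; [exact: T'T|exact: vp Tab].
    have one ab : (\bigcup_(X in F) X) ab -> exists T, [/\ F T, T ab & val_preorder T].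
      by move=> h; have [T []] := two _ _ h h; exists T.
    split.
    + by move=> a b ab; exists T1 => //; have [h _ _ _ _] := vT1; exact: h.
    + move=> b a c h1 h2; have [T [FT Tab Tbc [_ h _ _ _]]] := two _ _ h1 h2.
      by exists T => //; exact: h Tbc.
    + move=> a b c h1 h2; have [T [FT Tab Tbc [_ _ h _ _]]] := two _ _ h1 h2.
      by exists T => //; exact: h.
    + by move=> c a b /one[T [FT Tab [_ _ _ h _]]]; exists T => //; exact: h.
    + move=> s a b s0 /one[T [FT Tab [_ _ _ _ h]]]; exists T => //; exact: h Tab.
  - by move=> ab T0ab; exists T1 => //; exact: T01.
have {}Tgood : good T.
  case: Tgood => // T_0; case: (Tmax T0); last by right; split.
  rewrite T_0; split; first exact: sub0set.
  by move=> /(_ (0, 0)); apply; have [h _ _ _ _] := vT0; apply/h/sle_refl.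
have [vT T0T xT] := Tgood; exists T; split=> // p q.
apply: contrapT => /not_orP[npq nqp].
have escape u v : ~ T (u, v) -> impose T u v (x, y).
  move=> nuv; apply: contrapT => nx; apply: (Tmax (impose T u v)).
    split; first exact: impose_sub.
    by move=> /(_ _ (impose_le u v vT)).
  right; split=> //; first exact: impose_val_preorder.
  exact: subset_trans T0T (@impose_sub T u v).
apply: xT; apply: (impose_meet vT _ (escape _ _ npq) (escape _ _ nqp)).
apply/eqP => pq0; apply: npq; have [h _ _ _ _] := vT; apply: h.
by have := sle_addr p q; rewrite pq0 => /sle0 ->; exact: add0r.
Qed.

(** * The prime congruence of a total valuative preorder *)

Section PreorderCongruence.
Context T (vT : val_preorder T).

Definition preorder_rel : rel R := fun a b => `[< T (a, b) /\ T (b, a) >].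

Lemma preorder_rel_refl : reflexive preorder_rel.
Proof. by move=> a; have [h _ _ _ _] := vT; apply/asboolP; split; apply/h/sle_refl. Qed.

Lemma preorder_rel_sym : symmetric preorder_rel.
Proof. by move=> a b; apply/asboolP/asboolP => -[]. Qed.

Lemma preorder_rel_trans : transitive preorder_rel.
Proof.
move=> b a c /asboolP[ab ba] /asboolP[bc cb]; have [_ h _ _ _] := vT.
by apply/asboolP; split; [exact: h bc|exact: h ba].
Qed.

Definition preorder_equiv : equiv_rel R :=
  EquivRel preorder_rel preorder_rel_refl preorder_rel_sym preorder_rel_trans.

Lemma val_preorder_add a b c d : T (a, b) -> T (c, d) -> T (a + c, b + d).
Proof.
have [Tle Ttr Tadd _ _] := vT => ab cd; apply: Tadd.
  by apply: Ttr ab _; apply/Tle/sle_addr.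
by apply: Ttr cd _; apply/Tle/sle_addl.
Qed.

Lemma val_preorder_mul a b c d : T (a, b) -> T (c, d) -> T (a * c, b * d).
Proof.
have [_ Ttr _ Tmul _] := vT => ab cd; apply: (Ttr _ _ _ (Tmul a _ _ cd)).
by rewrite ![_ * d]mulrC; apply: Tmul.
Qed.

Lemma preorder_equiv_add a a' b b' :
  preorder_equiv a a' -> preorder_equiv b b' -> preorder_equiv (a + b) (a' + b').
Proof.
by move=> /asboolP[? ?] /asboolP[? ?]; apply/asboolP; split; apply: val_preorder_add.
Qed.

Lemma preorder_equiv_mul a a' b b' :
  preorder_equiv a a' -> preorder_equiv b b' -> preorder_equiv (a * b) (a' * b').
Proof.
by move=> /asboolP[? ?] /asboolP[? ?]; apply/asboolP; split; apply: val_preorder_mul.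
Qed.

Definition preorder_congr : congruence R :=
  Congruence preorder_equiv_add preorder_equiv_mul.

(** The order of the quotient is the one that T induces. *)
Lemma preorder_congrDr a b : preorder_congr (a + b) b <-> T (a, b).
Proof.
have [Tle Ttr Tadd _ _] := vT; split=> [/asboolP[Tab _]|Tab].
  by apply: Ttr Tab; apply/Tle/sle_addr.
by apply/asboolP; split; [apply: Tadd => //; apply/Tle/sle_refl|apply/Tle/sle_addl].
Qed.

Lemma preorder_congr_prime x y : ~ T (x, y) -> (forall p q, T (p, q) \/ T (q, p)) ->
  prime_congruence preorder_congr.
Proof.
move=> nx tot; split.
- by exists (x + y), y; apply/negP => /preorder_congrDr.
- elim/quot_ind=> a; elim/quot_ind=> b.
  have [ab|ba] := tot a b; [left|right]; rewrite /sle [LHS]quot_projD.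
    exact/quot_projP/preorder_congrDr.
  exact/quot_projP/preorder_congrDr.
- elim/quot_ind=> s s0; elim/quot_ind=> b; elim/quot_ind=> c.
  rewrite [LHS]quot_projM [RHS]quot_projM => /quot_projP/asboolP[bc cb].
  have s_neq0 : s != 0 by apply: contra_neq s0 => ->.
  have [_ _ _ _ h] := vT.
  by apply/quot_projP/asboolP; split; apply: h s_neq0 _.
Qed.

End PreorderCongruence.

End CancellativeSemiring.

(** * Valuation rings *)

Lemma frac_embedD (S : comPzSemiRingType) (a b : S) :
  frac_embed a + frac_embed b = frac_embed (a + b).
Proof. by rewrite [LHS]mkfracD; apply/mkfracP; rewrite /= !mulr1. Qed.

Lemma frac_embed_inj (S : comPzSemiRingType) : injective (@frac_embed S).
Proof. by move=> a b /mkfracP; rewrite /= !mulr1. Qed.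

(** The embedding into the fractions of R/P is injective, so the condition
    |x| <= 1 can be read off from P itself. *)
Lemma val_ringE (R : comPzSemiRingType) (P : congruence R) x : val_ring P x <-> P (x + 1) 1.
Proof.
rewrite /val_ring /= /sle /kappa_abs [X in _ + X = X](_ : 1 = frac_embed (quot_proj P 1)) //.
rewrite frac_embedD [X in frac_embed X]quot_projD.
by split=> [/frac_embed_inj/quot_projP|/quot_projP ->].
Qed.

(** * The integral closures *)

Section Closures.
Context (R : comPzSemiRingType) (A : set R).
Context (idemR : forall a : R, a + a = a) (cancelR : cancellative R).
Context (subA : semiring_closed [in A]).
Implicit Types (a b x y : R).

Let A0 : A 0.
Proof. by case: subA => -[/set_mem]. Qed.
Let A1 : A 1.
Proof. by case: subA => _ [/set_mem]. Qed.
Let AD a b : A a -> A b -> A (a + b).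
Proof. by case: subA => -[_ h] _ /mem_set Aa /mem_set Ab; apply/set_mem/h. Qed.
Let AM a b : A a -> A b -> A (a * b).
Proof. by case: subA => _ [_ h] /mem_set Aa /mem_set Ab; apply/set_mem/h. Qed.
Let Asum n (a : 'I_n -> R) : (forall i, A (a i)) -> A (\sum_i a i).
Proof. by move=> Aa; elim/big_ind: _. Qed.

Lemma sle_down_closure x s a : s != 0 -> A a -> x * s <=+ a * s -> down_closure A x.
Proof.
move=> s0 Aa; rewrite ![_ * s]mulrC => /(sle_cancel cancelR s0) xa.
by exists a.
Qed.

Lemma down_closure_trivial x : (1 : R) = 0 -> down_closure A x.
Proof. by move=> e; exists 0 => //; rewrite -[x]mul1r e mul0r; apply: sle_refl. Qed.

(** With s the sum of the powers of x below n and b dominating 1 and the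
    coefficients, x * s <=+ b * s: all terms of x * s but the top one occur in
    s, and the top one is bounded by the integral dependence. *)
Lemma j_integral_down_closure x : j_integral A x -> down_closure A x.
Proof.
move=> [[|n] [// _ [a [Aa xn]]]].
have [e|/eqP n10] := pselect ((1 : R) = 0); first exact: down_closure_trivial.
pose s := \sum_(i < n.+1) x ^+ i.
pose b := 1 + \sum_(i < n.+1) a i.
have sb : s <=+ b * s.
  by rewrite -[X in X <=+ _]mul1r; apply: (sle_mul _ (sle_refl _ _)) => //; apply: sle_addr.
apply: (@sle_down_closure x s b).
- apply: contra_neq n10 => s0; apply: sle0; rewrite -s0 /s.
  exact: (sle_sum idemR (fun i : 'I_n.+1 => x ^+ i) ord0).
- by apply: AD => //; apply: Asum.
rewrite mulr_sumr; apply: sum_sle => // i; rewrite -exprS.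
have [->|i_n] := eqVneq (val i) n.
  apply: sle_trans xn _; apply: sum_sle => // j; apply: sle_mul.
    apply: sle_trans (sle_sum idemR a j) _; exact: sle_addl.
  exact: (sle_sum idemR (fun i : 'I_n.+1 => x ^+ i)).
have i1n : (i.+1 < n.+1)%N by rewrite ltnS ltn_neqAle i_n -ltnS ltn_ord.
apply: sle_trans _ sb.
exact: (sle_sum idemR (fun i : 'I_n.+1 => x ^+ i) (Ordinal i1n)).
Qed.

Lemma down_closure_down_closed : down_closed (down_closure A).
Proof. by move=> x y xy [a Aa ya]; exists a => //; apply: sle_trans ya. Qed.

Lemma down_closure_sub : A `<=` down_closure A.
Proof. by move=> a Aa; exists a => //; apply: sle_refl. Qed.

Lemma down_closureD x y : down_closure A x -> down_closure A y -> down_closure A (x + y).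
Proof. by move=> [a Aa xa] [b Ab yb]; exists (a + b); [apply: AD|apply: sle_add]. Qed.

Lemma down_closureM x y : down_closure A x -> down_closure A y -> down_closure A (x * y).
Proof. by move=> [a Aa xa] [b Ab yb]; exists (a * b); [apply: AM|apply: sle_mul]. Qed.

Lemma down_closure_semiring_closed : semiring_closed [in down_closure A].
Proof.
split; split; do ?[by apply/mem_set/down_closure_sub].
- by move=> x y /set_mem hx /set_mem hy; apply/mem_set/down_closureD.
- by move=> x y /set_mem hx /set_mem hy; apply/mem_set/down_closureM.
Qed.

Lemma adjoin_down_closure x : down_closure A x -> adjoin A x `<=` down_closure A.
Proof.
move=> Ax; apply: smallest_sub => [|y [/down_closure_sub//|/= ->//]].
by split; [apply: down_closure_semiring_closed|apply: down_closure_down_closed].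
Qed.

(** As x is in the downward closure of A, so is all of the downward-closed
    semiring generated by A and x; hence the closure is a module over it, faithful as it contains 1
    and generated by 1 up to downward closure. *)
Lemma down_closure_quasi_integral x : down_closure A x -> quasi_integral A x.
Proof.
move=> Ax; exists (down_closure A); split.
- split; [exact: down_closure_sub|exact: down_closureD|].
  by move=> b m /(adjoin_down_closure Ax); apply: down_closureM.
- exists A; split=> //; last exact: down_closure_sub.
  exists [:: 1]; apply/seteqP; split=> [a Aa M [[_ _ Mm] M1]|].
    by rewrite -[a]mulr1; apply: Mm => //; apply: M1; rewrite /= inE.
  apply: smallest_sub; first by split.
  by move=> a /=; rewrite inE => /eqP ->.
- move=> a b _ _ /(_ 1); rewrite !mulr1; apply; exact: down_closure_sub.
Qed.

(** The sum m of the generators lies in M, and every element of M is below an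
    A-multiple of m; applied to x * m, this leaves x after cancellation of m. *)
Lemma quasi_integral_down_closure x : quasi_integral A x -> down_closure A x.
Proof.
move=> [M [[M0 _ Mmul] [L [[g Lg] LM ML]] faithM]].
pose m := \sum_(i < size g) g`_i.
have Lm y : L y -> exists2 a, A a & y <=+ a * m.
  rewrite Lg; move: y; apply: smallest_sub.
    split.
    - by exists 0 => //; rewrite mul0r; apply: sle_refl.
    - move=> y z [a Aa ya] [b Ab zb]; exists (a + b); first exact: AD.
      by rewrite mulrDl; apply: sle_add.
    - move=> a y Aa [b Ab yb]; exists (a * b); first exact: AM.
      by rewrite -mulrA; apply: sle_mul2l.
  move=> y /= /(nthP 0)[i ig <-]; exists 1 => //; rewrite mul1r.
  exact: (sle_sum idemR (fun i : 'I_(size g) => g`_i) (Ordinal ig)).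
have Mm y : M y -> exists2 a, A a & y <=+ a * m.
  rewrite ML => -[z /Lm[a Aa za] yz]; exists a => //; exact: sle_trans za.
have [m0|m0] := eqVneq m 0.
  apply: down_closure_trivial; apply: faithM.
  - by move=> I [[[_ [/set_mem I1 _]] _] _].
  - by move=> I [[[[/set_mem I0 _] _] _] _].
  - by move=> y /Mm[a _]; rewrite m0 mulr0 => /sle0 ->; rewrite !mulr0.
have MLm : M m.
  apply: LM; rewrite Lg => N [[N0 ND _] gN]; rewrite /m.
  elim/big_ind: _ => // i _; apply: gN; exact: mem_nth.
have /Mm[a Aa xa] : M (x * m).
  by apply: Mmul => // I [_]; apply; right.
exact: sle_down_closure xa.
Qed.

Lemma down_closure_v_closure : down_closure A `<=` v_closure A.
Proof.
move=> x [a Aa xa] P [_ AP].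
have /val_ringE Pa := AP _ Aa; apply/val_ringE.
have := congr_add (equiv_refl P x) Pa; rewrite addrA xa => Pxa.
by apply: equiv_trans Pa; rewrite equiv_sym.
Qed.

(** The least valuative preorder that relates every element of A to 1. *)
Definition multiple_preorder : set (R * R) :=
  [set rs | exists2 a, A a & rs.1 <=+ a * rs.2].

Lemma multiple_val_preorder : val_preorder multiple_preorder.
Proof.
split=> /=.
- by move=> a b ab; exists 1; rewrite ?mul1r.
- move=> b a c [u Au au] [v Av bv]; exists (u * v); first exact: AM.
  by apply: sle_trans au _; rewrite -mulrA; apply: sle_mul2l.
- move=> a b c [u Au au] [v Av bv]; exists (u + v); first exact: AD.
  by rewrite mulrDl; apply: sle_add.
- by move=> c a b [u Au au]; exists u => //; rewrite mulrCA; apply: sle_mul2l.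
- move=> s a b s0 [u Au]; rewrite mulrCA => /(sle_cancel cancelR s0) au.
  by exists u.
Qed.

(** Were x below no element of A, multiple_preorder would not relate x to 1, and
    a total preorder above it would give a prime congruence excluding x. *)
Lemma v_closure_down_closure : v_closure A `<=` down_closure A.
Proof.
move=> x vx; apply: contrapT => nx.
have nT : ~ multiple_preorder (x, 1).
  by move=> [a Aa /=]; rewrite mulr1 => xa; apply: nx; exists a.
have [T [vT subT xT totT]] :=
  exists_total_val_preorder idemR cancelR multiple_val_preorder nT.
suff /val_ringE/preorder_congrDr : val_ring (preorder_congr idemR vT) x by [].
apply: vx; split; first exact: preorder_congr_prime xT totT.
move=> a Aa; apply/val_ringE/preorder_congrDr/subT.
by exists a => //=; rewrite mulr1; apply: sle_refl.
Qed.

End Closures.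

Theorem theorem1p3 (R : comPzSemiRingType) (A : set R)
    (idemR : forall a : R, a + a = a)
    (cancelR : cancellative R)
    (subA : semiring_closed [in A]) :
  [/\ j_closure A = down_closure A,
      d_closure A = down_closure A,
      q_closure A = down_closure A
    & v_closure A = down_closure A].
Proof.
have jd : j_closure A = down_closure A.
  apply/seteqP; split=> [x|x [a Aa xa]]; first exact: j_integral_down_closure.
  exists 1%N; split=> //; exists (fun=> a); split=> //.
  by rewrite big_ord1 expr0 expr1 mulr1.
split=> //; apply/seteqP; split.
- move=> x [y]; rewrite -[j_integral A y]/(j_closure A y) jd => Ay xy.
  exact: down_closure_down_closed xy Ay.
- by move=> x; rewrite -jd => jx; exists x => //; apply: sle_refl.
- by move=> x; apply: quasi_integral_down_closure.
- by move=> x; apply: down_closure_quasi_integral.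
- exact: v_closure_down_closure.
- exact: down_closure_v_closure.
Qed.
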